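(* Let $m,n\ge 2$ and $1\le p\le\infty$. For all $A_1,\dots,A_m\in\mathbb{M}_n$, $$\Bigl\| \sum_{k=1}^m A_k \Bigr\|_p\ \le\ 2^{1-\frac1p}\,\Bigl\| \sum_{k=1}^m |A_k|_{\mathrm{sym}} \Bigr\|_p.$$ Moreover, the constant $2^{1-\frac1p}$ is sharp: if $c$ is a real number such that $\|\sum_{k=1}^m A_k\|_p\le c\,\|\sum_{k=1}^m|A_k|_{\mathrm{sym}}\|_p$ for all $A_1,\dots,A_m\in\mathbb{M}_n$, then $c\ge 2^{1-\frac1p}$.
   Context: $\mathbb{M}_n$ is the set of $n\times n$ complex matrices, $Z^*$ is the conjugate transpose of $Z$, $|Z|:=(Z^*Z)^{1/2}$, and the arithmetic symmetric modulus is $|Z|_{\mathrm{sym}}:=\frac{|Z|+|Z^*|}{2}$. For $1\le p<\infty$, the Schatten $p$-norm is $\|X\|_p:=(\operatorname{Tr}|X|^p)^{1/p}$; $\|X\|_\infty$ is the operator norm (largest singular value), and $\frac1\infty=0$. *)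

(* Defs.v *)
From mathcomp Require Import all_boot all_order all_algebra.
From mathcomp Require Import complex.
From mathcomp Require Import all_classical all_reals all_analysis.
Set Implicit Arguments.
Unset Strict Implicit.
Unset Printing Implicit Defensive.
Import Order.TTheory GRing.Theory Num.Theory.
Local Open Scope ring_scope.
Local Open Scope complex_scope.
Local Open Scope sesquilinear_scope.

Section Modulus.
Variables (R : realType) (n : nat).
Implicit Types A Z : 'M[R[i]]_n.

(* The continuous functional calculus: f applied to the eigenvalues of A in an
   orthonormal eigenbasis. It is only meaningful for Hermitian A, as
   [spectral_diag] has no meaning on matrices that are not normal. *)
Definition mxcalc (f : R -> R) A : 'M[R[i]]_n :=
  let P := spectralmx A in
  invmx P *m diag_mx (map_mx (fun z => (f (complex.Re z))%:C) (spectral_diag A))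
          *m P.

Definition absmx Z : 'M[R[i]]_n := mxcalc Num.sqrt (Z^t* *m Z).

Definition symabsmx Z : 'M[R[i]]_n :=
  2^-1 *: (absmx Z + absmx (Z^t*)).

Definition singular_value Z (i : 'I_n) : R :=
  complex.Re (spectral_diag (absmx Z) 0 i).

(* The value at -oo is a dummy. *)
Definition schatten (p : \bar R) Z : R :=
  match p with
  | r%:E => complex.Re (\tr (mxcalc (fun t => t `^ r) (absmx Z))) `^ r^-1
  | +oo%E => \big[Num.max/0]_(i < n) singular_value Z i
  | -oo%E => 0
  end.

End Modulus.

(* Main.v *)
Require Import Defs.
From mathcomp Require Import all_boot all_order all_algebra.
From mathcomp Require Import complex.
From mathcomp Require Import all_classical all_reals all_analysis.
From mathcomp Require Import ring lra.

(** Write [S = sum_k A_k], [X = sum_k |A_k|], [Y = sum_k |A_k^*|] and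
    [N = sum_k |A_k|_sym], so that [X + Y = 2 N].

    The polar decomposition of each [A_k] gives
    [Re (u A_k v^* ) <= (u |A_k^*| u^* + v |A_k| v^* ) / 2] for all vectors [u] and
    [v] (lemma [abs_bilinear_le]). Summing over [k] and taking for [u], [v] the
    singular vectors [u_i], [v_i] of [S] bounds its singular values:
    [s_i <= (u_i Y u_i^* + v_i X v_i^* ) / 2] (lemma [singular_value_sum_le]).

    For [p = oo] each of the two forms is at most the one of [X + Y = 2 N], so
    [s_i] is at most twice the norm of [N]. For finite [p], raise to the power [p]
    and sum. Convexity of [t^p], used at the midpoint and then for the diagonal
    entries of [X] and [Y] (lemma [sum_powR_qf_le]), gives
    [Tr |S|^p <= (Tr X^p + Tr Y^p) / 2]. McCarthy's inequality
    [Tr X^p + Tr Y^p <= Tr (X + Y)^p] (lemma [mccarthy]) bounds this by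
    [2^(p-1) Tr N^p], and the constant [2^(1-1/p)] appears when the [p]-th root is
    taken.

    McCarthy's inequality is reduced to [Tr X^p <= Tr (X Z^(p-1))] for
    [0 <= X <= Z], that is, to [x^q <= e Z^q e^*] with [q = p - 1] and [e] a unit
    eigenvector of [X] for the eigenvalue [x]. Although [Z^q >= X^q] fails in
    general when [q > 1], this scalar consequence holds for every [q >= 0]: the
    inequality [X <= Z] forces [x] to be at most the harmonic mean of the
    eigenvalues of [Z] in the state [e] (lemma [powR_eigenvalue_le]).

    Equality holds when one of the [A_k] is an off-diagonal unit matrix and the
    others vanish: [S] then has the single nonzero singular value [1], while [N]
    has the eigenvalue [1/2] twice, hence the norm [2^(1/p-1)]. *)

Local Open Scope ring_scope.

Set Implicit Arguments.
Unset Strict Implicit.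
Unset Printing Implicit Defensive.
Import Order.TTheory GRing.Theory Num.Theory.
Local Open Scope complex_scope.
Local Open Scope sesquilinear_scope.

(** * Tangent-line inequalities for real powers *)

Section ScalarInequalities.
Variable R : realType.
Implicit Types a b p q t x y : R.

(** Convexity of [t^q] as a function of [t^-1], at [t = 1]; it follows from
    [ln t >= 1 - t^-1]. All the convexity used below comes from this one tangent
    line. *)
Lemma powR_bernoulli_inv q t : 0 <= q -> 0 < t -> 1 + q * (1 - t^-1) <= t `^ q.
Proof.
move=> q0 t0; rewrite /powR gt_eqF//.
apply: le_trans (expR_ge1Dx _); rewrite lerD2l ler_wpM2l//.
have := expR_ge1Dx (- ln t); rewrite expRN lnK ?posrE//; lra.
Qed.

Lemma powR_bernoulli p t : 1 <= p -> 0 <= t -> 1 + p * (t - 1) <= t `^ p.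
Proof.
move=> p1; rewrite le_eqVlt => /predU1P[<-|t0].
  by rewrite powR0 ?gt_eqF//; lra.
rewrite -(mulr_powRB1 (ltW t0)); last lra.
have q0 : 0 <= p - 1 by lra.
apply: le_trans (ler_wpM2l (ltW t0) (powR_bernoulli_inv q0 t0)).
have -> : t * (1 + (p - 1) * (1 - t^-1)) = t + (p - 1) * (t - t * t^-1) by ring.
by rewrite divff ?gt_eqF//; lra.
Qed.

(** Since [t^p] vanishes at [0], convexity also covers weights of total mass less
    than [1], the missing mass being put at [0]: this is what lets partial
    isometries replace unitary matrices. The proof sums the tangent lines at the mean. *)
Lemma powR_jensen (I : finType) (w y : I -> R) p : 1 <= p ->
    (forall j, 0 <= w j) -> \sum_j w j <= 1 -> (forall j, 0 <= y j) ->
  (\sum_j w j * y j) `^ p <= \sum_j w j * y j `^ p.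
Proof.
move=> p1 w0 w1 y0; set a := \sum_j w j * y j.
have rhs0 : 0 <= \sum_j w j * y j `^ p.
  by apply: sumr_ge0 => j _; rewrite mulr_ge0 ?powR_ge0.
have : 0 <= a by apply: sumr_ge0 => j _; rewrite mulr_ge0.
rewrite le_eqVlt => /predU1P[<-|a0]; first by rewrite powR0//; apply/eqP; lra.
have tangent j : a `^ p * (1 + p * (y j / a - 1)) <= y j `^ p.
  rewrite -[in leRHS](divfK (lt0r_neq0 a0) (y j)) powRM ?divr_ge0 ?(ltW a0)//.
  by rewrite mulrC ler_wpM2r ?powR_ge0// powR_bernoulli// divr_ge0 ?(ltW a0).
apply: (@le_trans _ _ (\sum_j w j * (a `^ p * (1 + p * (y j / a - 1))))); last first.
  by apply: ler_sum => j _; rewrite ler_wpM2l.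
have -> : \sum_j w j * (a `^ p * (1 + p * (y j / a - 1))) =
          a `^ p * ((1 - p) * \sum_j w j + p / a * a).
  rewrite mulr_sumr {4}/a mulr_sumr -big_split mulr_sumr; apply: eq_bigr => j _ /=.
  by ring.
rewrite divfK ?gt_eqF// ler_peMr ?powR_ge0//; nra.
Qed.

Lemma powR_midpoint a b p : 1 <= p -> 0 <= a -> 0 <= b ->
  ((a + b) / 2) `^ p <= (a `^ p + b `^ p) / 2.
Proof.
move=> p1 a0 b0.
have := @powR_jensen bool (fun=> 2^-1) (fun c => if c then a else b) p p1.
rewrite !big_bool /= -!mulrDr ![2^-1 * _]mulrC; apply=> [_||[]//].
  by rewrite invr_ge0.
by have := splitr (1 : R); rewrite !div1r => <-.
Qed.

(** The last hypothesis says that [x] is at most the harmonic mean of [z] under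
    the weights [w], and harmonic means lie below power means. This holds for
    all [q >= 0], which avoids operator monotonicity and its restriction to
    [q <= 1]. The convention [0^-1 = 0] is harmless because zero values of [z]
    have weight zero. *)
Lemma powR_le_harmonic (I : finType) (w z : I -> R) (x q : R) :
    0 < x -> 0 <= q -> (forall j, 0 <= w j) -> \sum_j w j = 1 ->
    (forall j, 0 <= z j) -> (forall j, z j = 0 -> w j = 0) ->
    x * (\sum_j (z j)^-1 * w j) <= 1 ->
  x `^ q <= \sum_j w j * z j `^ q.
Proof.
move=> x0 q0 w0 w1 z0 zw0 xs.
apply: (@le_trans _ _ (\sum_j w j * (x `^ q * (1 + q * (1 - x * (z j)^-1))))).
  have -> : \sum_j w j * (x `^ q * (1 + q * (1 - x * (z j)^-1))) =
            x `^ q * ((1 + q) * \sum_j w j - q * (x * \sum_j (z j)^-1 * w j)).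
    rewrite !mulr_sumr -sumrB mulr_sumr; apply: eq_bigr => j _; ring.
  by rewrite ler_peMr ?powR_ge0// w1; nra.
apply: ler_sum => j _; have [zj|zj] := eqVneq (z j) 0.
  by rewrite zw0// !mul0r.
have zj0 : 0 < z j by rewrite lt_def zj z0.
rewrite ler_wpM2l// -[in leRHS](divfK (lt0r_neq0 x0) (z j)).
rewrite powRM ?divr_ge0 ?(ltW x0) ?(ltW zj0)// [leRHS]mulrC ler_wpM2l ?powR_ge0//.
by rewrite -[x * _]invf_div powR_bernoulli_inv ?divr_gt0.
Qed.

End ScalarInequalities.

(** * Real diagonal matrices, functional calculus and quadratic forms *)

Section Forms.
Variable R : realType.
Local Notation C := R[i].

(** The squared modulus, as a real number rather than as a complex one. *)
Definition nsq (z : C) : R := complex.Re z ^+ 2 + complex.Im z ^+ 2.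

Lemma nsq_ge0 z : 0 <= nsq z.
Proof. by rewrite addr_ge0 ?sqr_ge0. Qed.

Lemma nsqE (z : C) : z * z^* = (nsq z)%:C.
Proof.
case: z => a b; rewrite /nsq /=; apply/eqP; rewrite eq_complex /=.
by apply/andP; split; apply/eqP; ring.
Qed.

Lemma nsq_conj (z : C) : nsq z^* = nsq z.
Proof. by case: z => a b; rewrite /nsq /= sqrrN. Qed.

Lemma nsq_eq0 (z : C) : nsq z = 0 -> z = 0.
Proof.
case: z => a b /eqP; rewrite /nsq paddr_eq0 ?sqr_ge0//= !sqrf_eq0.
by move=> /andP[/eqP-> /eqP->].
Qed.

Lemma nsq_real (r : R) : nsq r%:C = r ^+ 2.
Proof. by rewrite /nsq /= expr0n addr0. Qed.

Lemma Re_sum (I : Type) (r : seq I) (P : pred I) (F : I -> C) :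
  complex.Re (\sum_(i <- r | P i) F i) = \sum_(i <- r | P i) complex.Re (F i).
Proof. by apply: (big_morph (@complex.Re R)) => // -[a b] [c d]. Qed.

Lemma Re_realM r (z : C) : complex.Re (r%:C * z) = r * complex.Re z.
Proof. by case: z => x y /=; rewrite mul0r subr0. Qed.

Lemma Re_conj_mul_le (a b : C) : complex.Re (a * b^*) <= (nsq a + nsq b) / 2.
Proof.
case: a b => [a1 a2] [b1 b2]; rewrite /nsq /=.
have := sqr_ge0 (a1 - b1); have := sqr_ge0 (a2 - b2).
rewrite !sqrrB; nra.
Qed.

Lemma trmxC_mul m n k (A : 'M[C]_(m, n)) (B : 'M[C]_(n, k)) :
  (A *m B)^t* = B^t* *m A^t*.
Proof. by rewrite trmx_mul map_mxM. Qed.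

Lemma trmxC_add m n (A B : 'M[C]_(m, n)) : (A + B)^t* = A^t* + B^t*.
Proof. by apply/matrixP => i j; rewrite !mxE rmorphD. Qed.

Lemma trmxC_scale_real n (a : R) (A : 'M[C]_n) : (a%:C *: A)^t* = a%:C *: A^t*.
Proof.
apply/matrixP => i j; rewrite !mxE rmorphM; congr (_ * _).
by apply/eqP; rewrite eq_complex /= oppr0 !eqxx.
Qed.

Lemma mulmx_trmxC_diag m n (A : 'M[C]_(m, n)) i :
  (A *m A^t*) i i = (\sum_j nsq (A i j))%:C.
Proof.
by rewrite mxE rmorph_sum; apply: eq_bigr => j _; rewrite !mxE; exact: nsqE.
Qed.

Definition rdiag n (d : 'I_n -> R) : 'M[C]_n := diag_mx (\row_j (d j)%:C).

Lemma trmxC_rdiag n (d : 'I_n -> R) : (rdiag d)^t* = rdiag d.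
Proof.
apply/matrixP => i j; rewrite !mxE eq_sym; case: eqP => [->|_]; last exact: rmorph0.
by rewrite !mulr1n; apply/eqP; rewrite eq_complex /= oppr0 !eqxx.
Qed.

Lemma rdiag_mul n (d e : 'I_n -> R) : rdiag d *m rdiag e = rdiag (fun i => d i * e i).
Proof.
rewrite /rdiag mulmx_diag; congr diag_mx; apply/rowP => j.
by rewrite !mxE rmorphM.
Qed.

Lemma eq_rdiag n (d e : 'I_n -> R) : d =1 e -> rdiag d = rdiag e.
Proof. by move=> de; congr diag_mx; apply/rowP => j; rewrite !mxE de. Qed.

(** When [P] is unitary this is the Hermitian matrix whose eigenvectors are the
    rows of [P]. It is also used with [P] a partial isometry, to describe the
    modulus of an adjoint. *)
Definition udiag n (P : 'M[C]_n) (d : 'I_n -> R) := P^t* *m rdiag d *m P.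

Lemma trmxC_udiag n (P : 'M[C]_n) d : (udiag P d)^t* = udiag P d.
Proof. by rewrite /udiag !trmxC_mul trmxCK trmxC_rdiag mulmxA. Qed.

Lemma unitarymx_inverse n (P : 'M[C]_n) : P \is unitarymx ->
  (P *m P^t* = 1%:M) * (P^t* *m P = 1%:M).
Proof. by move=> /unitarymxP PP; split=> //; apply: mulmx1C. Qed.

Lemma spectral_udiag n (A : 'M[C]_n) : A^t* = A ->
  A = udiag (spectralmx A) (fun i => complex.Re (spectral_diag A 0 i)).
Proof.
move=> AH; have Ah : A \is hermsymmx by apply/is_hermitianmxP; rewrite scale1r.
rewrite {1}(orthomx_spectralP (hermitian_normalmx Ah)).
rewrite (invmx_unitary (spectral_unitarymx A)) /udiag.
suff -> : diag_mx (spectral_diag A) =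
    rdiag (fun i => complex.Re (spectral_diag A 0 i)) by [].
rewrite /rdiag; congr diag_mx; apply/rowP => j; rewrite mxE RRe_real//.
exact: (mxOverP (hermitian_spectral_diag_real Ah)).
Qed.

Lemma eq_udiag n (P : 'M[C]_n) (d e : 'I_n -> R) : d =1 e -> udiag P d = udiag P e.
Proof. by move=> de; rewrite /udiag (eq_rdiag de). Qed.

Lemma mxcalcE (f : R -> R) n (A : 'M[C]_n) :
  mxcalc f A = udiag (spectralmx A) (f \o fun i => complex.Re (spectral_diag A 0 i)).
Proof.
rewrite /mxcalc (invmx_unitary (spectral_unitarymx A)) /udiag /rdiag.
suff -> : map_mx (fun z => (f (complex.Re z))%:C) (spectral_diag A) =
    \row_j ((f \o fun i => complex.Re (spectral_diag A 0 i)) j)%:C by [].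
by apply/rowP => j; rewrite !mxE.
Qed.

(** The entries satisfy [d_i W_ij = W_ij l_j], so where [W_ij] is nonzero the
    eigenvalues [d_i] and [l_j] agree, and so do their images under [f]. *)
Lemma rdiag_intertwine (f : R -> R) n (d l : 'I_n -> R) (W : 'M[C]_n) :
  rdiag d *m W = W *m rdiag l -> rdiag (f \o d) *m W = W *m rdiag (f \o l).
Proof.
move=> dW; apply/matrixP => i j; move/matrixP/(_ i j): dW.
rewrite /rdiag !mul_diag_mx !mul_mx_diag !mxE /=.
have [-> _|W0] := eqVneq (W i j) 0; first by rewrite mulr0 mul0r.
by rewrite [W i j * _]mulrC => /(mulIf W0)/complexI ->; rewrite mulrC.
Qed.

(** The functional calculus does not depend on the eigenbasis: two unitary
    diagonalizations of one matrix are intertwined by the product of their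
    changes of basis. *)
Lemma mxcalc_udiag (f : R -> R) n (P : 'M[C]_n) d : P \is unitarymx ->
  mxcalc f (udiag P d) = udiag P (f \o d).
Proof.
move=> Pu; rewrite mxcalcE; set A := udiag P d.
have := spectral_udiag (trmxC_udiag P d); rewrite -/A.
move: (spectralmx A) (spectral_unitarymx A) (fun i => complex.Re _) => Q Qu l.
rewrite /A /udiag => AE.
have [PP P'P] := unitarymx_inverse Pu; have [QQ Q'Q] := unitarymx_inverse Qu.
pose W := P *m Q^t*.
have WE : rdiag d *m W = W *m rdiag l.
  have : P *m (P^t* *m rdiag d *m P) *m Q^t* = P *m (Q^t* *m rdiag l *m Q) *m Q^t*.
    by rewrite AE.
  by rewrite !mulmxA PP mul1mx -[_ *m Q *m Q^t*]mulmxA QQ mulmx1 /W -!mulmxA.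
have fWE := rdiag_intertwine f WE.
have := congr1 (fun M => P^t* *m M *m Q) fWE => /=.
rewrite /W !mulmxA P'P mul1mx -[_ *m Q^t* *m Q]mulmxA Q'Q mulmx1.
exact: esym.
Qed.

(** The form [u A u^*]; for Hermitian [A] it is real, so that taking the real
    part loses nothing. *)
Definition qf n (A : 'M[C]_n) (u : 'rV[C]_n) : R := complex.Re ((u *m A *m u^t*) 0 0).

Lemma qfD n (A B : 'M[C]_n) u : qf (A + B) u = qf A u + qf B u.
Proof. by rewrite /qf mulmxDr mulmxDl mxE; case: (_ 0 0) => ? ?; case: (_ 0 0). Qed.

Lemma qf_scale n (a : R) (A : 'M[C]_n) u : qf (a%:C *: A) u = a * qf A u.
Proof. by rewrite /qf -scalemxAr -scalemxAl mxE Re_realM. Qed.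

Lemma qf_sum n (I : finType) (A : I -> 'M[C]_n) u :
  qf (\sum_k A k) u = \sum_k qf (A k) u.
Proof. by rewrite /qf mulmx_sumr mulmx_suml summxE Re_sum. Qed.

Lemma qf_rdiag n (d : 'I_n -> R) (c : 'rV[C]_n) :
  qf (rdiag d) c = \sum_j d j * nsq (c 0 j).
Proof.
rewrite /qf mxE Re_sum; apply: eq_bigr => j _.
rewrite /rdiag mul_mx_diag !mxE mulrAC mulrC.
have -> : c 0 j * Num.conj (c 0 j) = (nsq (c 0 j))%:C by exact: nsqE.
by rewrite /= mulr0 subr0.
Qed.

Lemma qf_udiag n (P : 'M[C]_n) d u :
  qf (udiag P d) u = \sum_j d j * nsq ((u *m P^t*) 0 j).
Proof. by rewrite -qf_rdiag /qf /udiag trmxC_mul trmxCK !mulmxA. Qed.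

Lemma qf_udiag_mulrow n (U Q : 'M[C]_n) d i :
  qf (udiag Q d) (row i U) = \sum_j d j * nsq ((U *m Q^t*) i j).
Proof. by rewrite qf_udiag -row_mul; apply: eq_bigr => j _; rewrite mxE. Qed.

Lemma qf_udiag_row n (P : 'M[C]_n) d i : P \is unitarymx ->
  qf (udiag P d) (row i P) = d i.
Proof.
move=> /unitarymxP PP; rewrite qf_udiag -row_mul PP (bigD1 i)//= big1 => [|j ji].
  by rewrite addr0 !mxE eqxx /nsq /= expr1n expr0n addr0 mulr1.
by rewrite !mxE eq_sym (negbTE ji) /nsq /= expr0n addr0 mulr0.
Qed.

Lemma qf_udiag_ge0 n (P : 'M[C]_n) d u : (forall i, 0 <= d i) ->
  0 <= qf (udiag P d) u.
Proof.
by move=> d0; rewrite qf_udiag sumr_ge0// => j _; rewrite mulr_ge0 ?nsq_ge0.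
Qed.

Lemma qf_gram_ge0 n (Z : 'M[C]_n) u : 0 <= qf (Z^t* *m Z) u.
Proof.
have -> : qf (Z^t* *m Z) u = complex.Re (((u *m Z^t*) *m (u *m Z^t*)^t*) 0 0).
  by rewrite trmxC_mul trmxCK /qf !mulmxA.
by rewrite mulmx_trmxC_diag sumr_ge0// => j _; exact: nsq_ge0.
Qed.

(** * Positive semidefinite matrices *)

Definition psd n (A : 'M[C]_n) := A^t* = A /\ forall u, 0 <= qf A u.

Lemma psdD n (A B : 'M[C]_n) : psd A -> psd B -> psd (A + B).
Proof.
move=> [AH A0] [BH B0]; split=> [|u]; first by rewrite trmxC_add AH BH.
by rewrite qfD addr_ge0.
Qed.

Lemma psd_scale n (a : R) (A : 'M[C]_n) : 0 <= a -> psd A -> psd (a%:C *: A).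
Proof.
move=> a0 [AH A0]; split=> [|u]; first by rewrite trmxC_scale_real AH.
by rewrite qf_scale mulr_ge0.
Qed.

Lemma psd_sum n (I : finType) (A : I -> 'M[C]_n) :
  (forall k, psd (A k)) -> psd (\sum_k A k).
Proof.
move=> A0; split=> [|u]; last by rewrite qf_sum sumr_ge0// => k _; case: (A0 k).
rewrite linear_sum /= (raddf_sum (map_mx Num.conj)); apply: eq_bigr => k _.
by case: (A0 k).
Qed.

Lemma psd_spectral n (A : 'M[C]_n) : psd A ->
  let l i := complex.Re (spectral_diag A 0 i) in
  A = udiag (spectralmx A) l /\ forall i, 0 <= l i.
Proof.
move=> [AH A0] l; have AE : A = udiag (spectralmx A) l := spectral_udiag AH.
split=> // i; rewrite -(@qf_udiag_row _ (spectralmx A) l) ?spectral_unitarymx//.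
by rewrite -AE.
Qed.

Lemma psd_diagonalization n (A : 'M[C]_n) : psd A ->
  exists P d, [/\ P \is unitarymx, forall i, 0 <= d i & A = udiag P d].
Proof.
move=> /psd_spectral[AE l0].
exists (spectralmx A), (fun i => complex.Re (spectral_diag A 0 i)).
by split=> //; exact: spectral_unitarymx.
Qed.

Lemma udiag_psd n (P : 'M[C]_n) d : (forall i, 0 <= d i) -> psd (udiag P d).
Proof. by move=> d0; split=> [|u]; [exact: trmxC_udiag|exact: qf_udiag_ge0]. Qed.

Lemma udiag_mul n (P : 'M[C]_n) d e : P \is unitarymx ->
  udiag P d *m udiag P e = udiag P (fun i => d i * e i).
Proof.
move=> /unitarymxP PP.
by rewrite /udiag -rdiag_mul !mulmxA -[_ *m P *m P^t*]mulmxA PP mulmx1.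
Qed.

(** Uniqueness of the positive square root: in an eigenbasis of [G], the
    matrix [Z^* Z = G^2] is diagonal with the squares of the eigenvalues of [G]. *)
Lemma absmx_unique n (Z G : 'M[C]_n) : psd G -> G *m G = Z^t* *m Z -> absmx Z = G.
Proof.
move=> /psd_diagonalization[Q [g [Qu g0 ->]]]; rewrite (udiag_mul _ _ Qu) => GG.
rewrite /absmx -GG (mxcalc_udiag _ _ Qu).
by apply: eq_udiag => i /=; rewrite -expr2 sqrtr_sqr ger0_norm.
Qed.

Lemma psd_gram n (Z : 'M[C]_n) : psd (Z^t* *m Z).
Proof. by split=> [|u]; [rewrite trmxC_mul trmxCK|exact: qf_gram_ge0]. Qed.

Lemma absmxP n (Z : 'M[C]_n) : psd (absmx Z) /\ absmx Z *m absmx Z = Z^t* *m Z.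
Proof.
rewrite /absmx mxcalcE; split; first by apply: udiag_psd => i; exact: sqrtr_ge0.
have [ZE l0] := psd_spectral (psd_gram Z).
rewrite [RHS]ZE (udiag_mul _ _ (spectral_unitarymx _)).
by apply: eq_udiag => i /=; rewrite -expr2 sqr_sqrtr.
Qed.

Lemma absmx_psd_id n (G : 'M[C]_n) : psd G -> absmx G = G.
Proof. by move=> G0; apply: absmx_unique => //; case: G0 => ->. Qed.

(** * Partial isometries *)

Lemma unitary_row_sum n (P : 'M[C]_n) i : P \is unitarymx -> \sum_j nsq (P i j) = 1.
Proof.
move=> /unitarymxP PP; have := mulmx_trmxC_diag P i.
by rewrite PP mxE eqxx => /complexI.
Qed.

(** [G = U U^*] is a Hermitian idempotent, so its diagonal entry satisfies
    [G_ii = sum_k |G_ik|^2 >= G_ii^2]; that entry is the squared norm of the row. *)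
Lemma partial_isometry_row n (U : 'M[C]_n) i : U *m U^t* *m U = U ->
  \sum_j nsq (U i j) <= 1.
Proof.
move=> UUU; set c := \sum_j _.
pose G := U *m U^t*.
have GE : G i i = c%:C by exact: mulmx_trmxC_diag.
have GG : G *m G^t* = G by rewrite /G trmxC_mul trmxCK mulmxA UUU.
have := mulmx_trmxC_diag G i; rewrite GG GE => /complexI.
rewrite (bigD1 i)//= GE {1}/nsq /= expr0n addr0 => cE.
have : c ^+ 2 <= c.
  by rewrite [leRHS]cE lerDl sumr_ge0// => j _; exact: nsq_ge0.
have : 0 <= c by rewrite sumr_ge0// => j _; exact: nsq_ge0.
rewrite expr2; nra.
Qed.

Lemma partial_isometry_adj n (U : 'M[C]_n) : U *m U^t* *m U = U ->
  U^t* *m U^t* ^t* *m U^t* = U^t*.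
Proof. by move=> UUU; rewrite trmxCK -{4}UUU !trmxC_mul trmxCK mulmxA. Qed.

Lemma partial_isometry_col n (U : 'M[C]_n) j : U *m U^t* *m U = U ->
  \sum_i nsq (U i j) <= 1.
Proof.
move=> /partial_isometry_adj/(@partial_isometry_row _ _ j).
by under eq_bigr do rewrite !mxE nsq_conj.
Qed.

Lemma unitary_partial_isometry n (P : 'M[C]_n) : P \is unitarymx ->
  P *m P^t* *m P = P.
Proof. by move=> /unitarymxP ->; rewrite mul1mx. Qed.

Lemma partial_isometry_mul_unitary n (U Q : 'M[C]_n) :
  U *m U^t* *m U = U -> Q \is unitarymx ->
  (U *m Q^t*) *m (U *m Q^t*)^t* *m (U *m Q^t*) = U *m Q^t*.
Proof.
move=> UUU Qu; have [_ QQ] := unitarymx_inverse Qu.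
by rewrite trmxC_mul trmxCK !mulmxA -[U *m Q^t* *m Q]mulmxA QQ mulmx1 UUU.
Qed.

(** * Singular value decomposition *)

(** The modulus of the adjoint is carried by the left singular vectors, the rows
    of [U], since [Z Z^* = G^2] for [G = U^* s U]. *)
Lemma absmx_adj_svd n (U P : 'M[C]_n) s : (forall i, 0 <= s i) ->
    P \is unitarymx -> U *m U^t* *m rdiag s = rdiag s ->
  absmx ((U^t* *m rdiag s *m P)^t*) = udiag U s.
Proof.
move=> s0 /unitarymxP PP UUs; apply: absmx_unique; first exact: udiag_psd.
rewrite trmxCK [in RHS]trmxC_mul -[RHS]mulmxA [in RHS](mulmxA P) PP mul1mx.
rewrite trmxC_mul trmxCK trmxC_rdiag /udiag -!mulmxA.
by rewrite [U *m (U^t* *m _)]mulmxA [U *m U^t* *m _]mulmxA UUs.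
Qed.

(** The left singular vectors are [s_i^-1 P_i Z^*], taken to be zero when
    [s_i = 0]. Not completing them to an orthonormal basis makes [U] a partial
    isometry, which is all that the trace inequalities need. *)
Lemma svd_of_absmx n (Z P : 'M[C]_n) s : P \is unitarymx ->
    (forall i, 0 <= s i) -> absmx Z = udiag P s ->
  exists U : 'M[C]_n, [/\ U *m U^t* *m U = U, Z = U^t* *m rdiag s *m P,
    U *m Z *m P^t* = rdiag s & absmx (Z^t*) = udiag U s].
Proof.
move=> Pu s0 ZE; have [_ ZZ] := absmxP Z.
have [PP P'P] := unitarymx_inverse Pu.
pose B := Z *m P^t*.
have BB : B^t* *m B = rdiag (fun i => s i * s i).
  rewrite /B trmxC_mul trmxCK mulmxA -[P *m _ *m _]mulmxA -ZZ ZE /udiag.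
  rewrite !mulmxA PP mul1mx -[_ *m P *m P^t*]mulmxA PP mulmx1.
  by rewrite -[_ *m P *m P^t*]mulmxA PP mulmx1 rdiag_mul.
have B0 i j : s i = 0 -> B^t* i j = 0.
  move=> si0; have := mulmx_trmxC_diag (B^t*) i; rewrite trmxCK BB.
  have -> : rdiag (fun i => s i * s i) i i = 0%:C.
    by rewrite !mxE eqxx mulr1n si0 mulr0.
  move=> /complexI/esym/eqP.
  rewrite psumr_eq0 => [/allP/(_ j)|? _]; last exact: nsq_ge0.
  by rewrite mem_index_enum => /(_ isT)/eqP/nsq_eq0.
pose U := rdiag (fun i => (s i)^-1) *m B^t*.
have UH : U^t* = B *m rdiag (fun i => (s i)^-1).
  by rewrite /U trmxC_mul trmxCK trmxC_rdiag.
have ZU : Z = U^t* *m rdiag s *m P.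
  rewrite UH -[B *m _ *m _]mulmxA rdiag_mul.
  suff -> : B *m rdiag (fun i => (s i)^-1 * s i) = B.
    by rewrite /B -mulmxA P'P mulmx1.
  rewrite -[LHS]trmxCK -[RHS]trmxCK; congr (_^t*); rewrite trmxC_mul trmxC_rdiag.
  apply/matrixP => i j; rewrite /rdiag mul_diag_mx mxE [in X in X * _]mxE.
  have [si|si] := eqVneq (s i) 0; first by rewrite B0// mulr0.
  by rewrite mulVf// mul1r.
have pinvM i : (s i)^-1 * (s i * s i) * (s i)^-1 * s i = s i.
  by have [->|si] := eqVneq (s i) 0; [rewrite mulr0|field].
have pinvV i : (s i)^-1 * (s i * s i) * (s i)^-1 * (s i)^-1 = (s i)^-1.
  by have [->|si] := eqVneq (s i) 0; [rewrite invr0 !mulr0|field].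
have UU : U *m U^t* = rdiag (fun i => (s i)^-1 * (s i * s i) * (s i)^-1).
  by rewrite UH /U mulmxA -[_ *m B^t* *m B]mulmxA BB !rdiag_mul.
have UUs : U *m U^t* *m rdiag s = rdiag s.
  by rewrite UU rdiag_mul; apply: eq_rdiag => i; rewrite pinvM.
exists U; split.
- rewrite UU {1}/U mulmxA rdiag_mul.
  by rewrite (@eq_rdiag _ _ (fun i => (s i)^-1))// => i; rewrite pinvV.
- exact: ZU.
- by rewrite ZU !mulmxA UUs -mulmxA PP mulmx1.
- by rewrite ZU (absmx_adj_svd s0 Pu UUs).
Qed.

Lemma svd n (Z : 'M[C]_n) :
  (forall i, 0 <= singular_value Z i) /\
  exists P U : 'M[C]_n, [/\ P \is unitarymx /\ U *m U^t* *m U = U,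
    Z = U^t* *m rdiag (singular_value Z) *m P,
    U *m Z *m P^t* = rdiag (singular_value Z),
    absmx Z = udiag P (singular_value Z) &
    absmx (Z^t*) = udiag U (singular_value Z)].
Proof.
have [ZE s0] := psd_spectral (absmxP Z).1.
have Pu := spectral_unitarymx (absmx Z).
have [U [UUU ZU UZ ZaE]] := svd_of_absmx Pu s0 ZE.
by split=> //; exists (spectralmx (absmx Z)), U; split.
Qed.

(** This says that the block matrix with rows [|Z^*|, -Z] and [-Z^*, |Z|] is
    positive. In singular coordinates [a = u U^*], [b = v P^*] it is
    [Re (a_j conj(b_j)) <= (|a_j|^2 + |b_j|^2) / 2], weighted by [s_j]. *)
Lemma abs_bilinear_le n (Z : 'M[C]_n) (u v : 'rV[C]_n) :
  complex.Re ((u *m Z *m v^t*) 0 0) <= (qf (absmx (Z^t*)) u + qf (absmx Z) v) / 2.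
Proof.
have [s0 [P [U [_ ZU _ -> ->]]]] := svd Z.
rewrite {1}ZU !qf_udiag; move: (singular_value Z) s0 => s s0.
have -> : u *m (U^t* *m rdiag s *m P) *m v^t* =
    (u *m U^t*) *m rdiag s *m (v *m P^t*)^t*.
  by rewrite trmxC_mul trmxCK !mulmxA.
move: (u *m U^t*) (v *m P^t*) => a b.
rewrite mxE Re_sum -big_split mulr_suml; apply: ler_sum => j _ /=.
rewrite /rdiag mul_mx_diag !mxE -mulrDr -[leRHS]mulrA.
apply: le_trans (ler_wpM2l (s0 j) (Re_conj_mul_le _ _)).
have -> : a 0 j * (s j)%:C * Num.conj (b 0 j) = (s j)%:C * (a 0 j * (b 0 j)^*).
  by rewrite mulrAC mulrC.
by rewrite Re_realM.
Qed.

End Forms.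

(** * Trace inequalities *)

Section TraceInequalities.
Variable R : realType.
Local Notation C := R[i].

(** The Peierls inequality: diagonal entries of [Y] are averages of its
    eigenvalues with doubly substochastic weights. Row sums of the weights are
    consumed by Jensen, column sums by exchanging the sums. *)
Lemma sum_powR_qf_le n (U Q : 'M[C]_n) (y : 'I_n -> R) p :
    1 <= p -> U *m U^t* *m U = U -> Q \is unitarymx -> (forall j, 0 <= y j) ->
  \sum_i qf (udiag Q y) (row i U) `^ p <= \sum_j y j `^ p.
Proof.
move=> p1 UUU Qu y0; have VVV := partial_isometry_mul_unitary UUU Qu.
set V := U *m Q^t* in VVV.
apply: (@le_trans _ _ (\sum_i \sum_j nsq (V i j) * y j `^ p)).
  apply: ler_sum => i _; rewrite qf_udiag_mulrow.
  under eq_bigr do rewrite mulrC.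
  apply: powR_jensen => // [j|]; first exact: nsq_ge0.
  exact: partial_isometry_row.
rewrite exchange_big /=; apply: ler_sum => j _.
by rewrite -mulr_suml ler_piMl ?powR_ge0// partial_isometry_col.
Qed.

Lemma qf_udiag_row_le n (U Q : 'M[C]_n) (d : 'I_n -> R) i M :
    U *m U^t* *m U = U -> Q \is unitarymx -> 0 <= M -> (forall j, d j <= M) ->
  qf (udiag Q d) (row i U) <= M.
Proof.
move=> UUU Qu M0 dM; have VVV := partial_isometry_mul_unitary UUU Qu.
rewrite qf_udiag_mulrow.
apply: (@le_trans _ _ (\sum_j M * nsq ((U *m Q^t*) i j))).
  by apply: ler_sum => j _; rewrite ler_wpM2r ?nsq_ge0.
by rewrite -mulr_sumr ler_piMr// partial_isometry_row.
Qed.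

(** The hypothesis is tested on the vector whose coordinates in the eigenbasis
    [Q] are [g_j V_ij], with [V = P Q^*]; only the [i]-th eigenvalue of the
    smaller matrix is kept. *)
Lemma eigenvalue_test n (P Q : 'M[C]_n) (x z : 'I_n -> R) i (g : 'I_n -> R)
    (w := fun j => nsq ((P *m Q^t*) i j)) :
    P \is unitarymx -> Q \is unitarymx -> (forall i, 0 <= x i) ->
    (forall u, qf (udiag P x) u <= qf (udiag Q z) u) ->
  x i * (\sum_j g j * w j) ^+ 2 <= \sum_j z j * (g j ^+ 2 * w j).
Proof.
move=> Pu Qu x0 XZ; set V := P *m Q^t* in w *.
pose c : 'rV[C]_n := \row_j ((g j)%:C * V i j).
have := XZ (c *m Q); rewrite !qf_udiag.
have [QQ _] := unitarymx_inverse Qu.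
have -> : c *m Q *m P^t* = c *m V^t* by rewrite /V trmxC_mul trmxCK mulmxA.
rewrite -[c *m Q *m _]mulmxA QQ mulmx1.
have -> : \sum_j z j * nsq (c 0 j) = \sum_j z j * (g j ^+ 2 * w j).
  apply: eq_bigr => j _; rewrite /c /w mxE; congr (_ * _).
  by case: (V i j) => a b; rewrite /nsq /=; ring.
apply: le_trans; rewrite [leRHS](bigD1 i)//=.
have -> : (c *m V^t*) 0 i = (\sum_j g j * w j)%:C.
  rewrite mxE rmorph_sum; apply: eq_bigr => j _; rewrite /c /w.
  move: (V) => V'; rewrite !mxE -mulrA rmorphM; congr (_ * _); exact: nsqE.
rewrite nsq_real lerDl sumr_ge0// => j _.
by rewrite mulr_ge0 ?nsq_ge0.
Qed.

(** With [e] a unit eigenvector of [X] for [x_i], [X <= Z] gives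
    [e Z^-1 e^* <= 1 / x_i] on the range of [Z], and [e] has no component in the
    kernel of [Z]. So [x_i] is below the harmonic mean of the eigenvalues of [Z]
    weighted by [e]: the conclusion [x_i^q <= e Z^q e^*] follows for every [q >= 0]. *)
Lemma powR_eigenvalue_le n (P Q : 'M[C]_n) (x z : 'I_n -> R) i q :
    P \is unitarymx -> Q \is unitarymx ->
    (forall i, 0 <= x i) -> (forall j, 0 <= z j) ->
    (forall u, qf (udiag P x) u <= qf (udiag Q z) u) -> 0 <= q -> 0 < x i ->
  x i `^ q <= \sum_j nsq ((P *m Q^t*) i j) * z j `^ q.
Proof.
move=> Pu Qu x0 z0 XZ q0 xi0.
have test g := eigenvalue_test i g Pu Qu x0 XZ.
have Vu : P *m Q^t* \is unitarymx by apply: (mul_unitarymx Pu); rewrite trmxC_unitary.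
set w := fun j => nsq ((P *m Q^t*) i j) in test *.
have w0 j : 0 <= w j by exact: nsq_ge0.
apply: (@powR_le_harmonic _ _ w) => //; first exact: unitary_row_sum.
  move=> j zj; have := test (fun k => (k == j)%:R).
  rewrite (bigD1 j)//= big1 => [|k /negbTE->]; last by rewrite mul0r.
  rewrite [leRHS](bigD1 j)//= [in leRHS]big1 => [|k /negbTE->]; last first.
    by rewrite expr0n mul0r mulr0.
  rewrite eqxx mul1r zj mul0r !addr0 pmulr_rle0// => w2.
  by apply/eqP; rewrite -sqrf_eq0 eq_le w2 sqr_ge0.
have := test (fun k => (z k)^-1); set s := \sum_j _.
have -> : \sum_j z j * ((z j)^-1 ^+ 2 * w j) = s.
  apply: eq_bigr => j _; have [->|zj] := eqVneq (z j) 0; last first.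
    by rewrite mulrA expr2 mulrA divff// mul1r.
  by rewrite invr0 !mul0r.
have s0 : 0 <= s.
  by apply: sumr_ge0 => j _; apply: mulr_ge0 (w0 j); rewrite invr_ge0.
have [->|sn0] := eqVneq s 0; first by move=> _; rewrite mulr0 ler01.
by rewrite expr2 mulrA ger_pMl// lt_def sn0.
Qed.

(** The bounds [x_i^(p-1) <= e_i Z^(p-1) e_i^*] for an eigenbasis [e_i] of [X],
    weighted by [x_i], add up to [Tr X^p <= Tr (X Z^(p-1))]; the trace on the
    right is written in the eigenbasis of [Z], where it is additive in [X]. *)
Lemma sum_powR_le n (P Q : 'M[C]_n) (x z : 'I_n -> R) p :
    P \is unitarymx -> Q \is unitarymx ->
    (forall i, 0 <= x i) -> (forall j, 0 <= z j) ->
    (forall u, qf (udiag P x) u <= qf (udiag Q z) u) -> 1 <= p ->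
  \sum_i x i `^ p <= \sum_j z j `^ (p - 1) * qf (udiag P x) (row j Q).
Proof.
move=> Pu Qu x0 z0 XZ p1.
apply: (@le_trans _ _
  (\sum_i x i * \sum_j nsq ((P *m Q^t*) i j) * z j `^ (p - 1))).
  apply: ler_sum => i _; rewrite -mulr_powRB1//; last lra.
  have := x0 i; rewrite le_eqVlt => /predU1P[<-|xi0]; first by rewrite !mul0r.
  by rewrite ler_wpM2l// powR_eigenvalue_le//; lra.
under eq_bigr do rewrite mulr_sumr.
rewrite exchange_big /=; apply: ler_sum => j _.
rewrite qf_udiag_mulrow mulr_sumr; apply: ler_sum => i _.
have -> : Q *m P^t* = (P *m Q^t*)^t* by rewrite trmxC_mul trmxCK.
move: (P *m Q^t*) => V; rewrite !mxE nsq_conj.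
by rewrite [leRHS]mulrCA [z j `^ _ * _]mulrC.
Qed.

(** McCarthy's inequality [Tr X^p + Tr Y^p <= Tr (X + Y)^p]: add
    [Tr X^p <= Tr (X Z^(p-1))] to the same bound for [Y], with [Z = X + Y]. *)
Lemma mccarthy n (P O Q : 'M[C]_n) (x y z : 'I_n -> R) p :
    P \is unitarymx -> O \is unitarymx -> Q \is unitarymx ->
    (forall i, 0 <= x i) -> (forall i, 0 <= y i) -> (forall j, 0 <= z j) ->
    (forall u, qf (udiag P x) u + qf (udiag O y) u = qf (udiag Q z) u) ->
    1 <= p ->
  \sum_i x i `^ p + \sum_i y i `^ p <= \sum_j z j `^ p.
Proof.
move=> Pu Ou Qu x0 y0 z0 XYZ p1.
have XZ u : qf (udiag P x) u <= qf (udiag Q z) u.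
  by rewrite -XYZ lerDl qf_udiag_ge0.
have YZ u : qf (udiag O y) u <= qf (udiag Q z) u.
  by rewrite -XYZ lerDr qf_udiag_ge0.
apply: le_trans (lerD (sum_powR_le Pu Qu x0 z0 XZ p1) (sum_powR_le Ou Qu y0 z0 YZ p1)) _.
rewrite -big_split /=; apply: ler_sum => j _.
rewrite -mulrDr XYZ qf_udiag_row// mulrC mulr_powRB1//; lra.
Qed.

End TraceInequalities.

(** * Schatten norms of sums *)

Section SchattenNorm.
Variable R : realType.
Local Notation C := R[i].

Lemma schatten_fin n r (Z P : 'M[C]_n) d : P \is unitarymx ->
  absmx Z = udiag P d -> schatten r%:E Z = (\sum_i d i `^ r) `^ r^-1.
Proof.
move=> Pu ZE; rewrite /schatten ZE (mxcalc_udiag _ _ Pu); congr (_ `^ _).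
have [PP _] := unitarymx_inverse Pu.
rewrite /udiag mxtrace_mulC mulmxA PP mul1mx /rdiag mxtrace_diag Re_sum.
by apply: eq_bigr => i _; rewrite mxE.
Qed.

(** The norm is defined from one particular diagonalization of [absmx Z]; the
    maximum is the same for any other, since each eigenvalue is a value of the
    form on a unit vector, hence at most the largest eigenvalue. *)
Lemma schatten_inf n (Z P : 'M[C]_n) d : P \is unitarymx -> (forall i, 0 <= d i) ->
  absmx Z = udiag P d -> schatten +oo%E Z = \big[Num.max/0]_i d i.
Proof.
move=> Pu d0 ZE; have [s0 [Q [_ [[Qu _] _ _ ZE' _]]]] := svd Z; rewrite /schatten.
move: (singular_value Z) ZE' s0 => s; rewrite ZE => ZE' s0.
have maxP (e : 'I_n -> R) : 0 <= \big[Num.max/0]_i e i /\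
    forall i, e i <= \big[Num.max/0]_i e i.
  by split=> [|i]; [exact: bigmax_ge_id|exact: le_bigmax].
apply/eqP; rewrite eq_le; apply/andP; split; apply: bigmax_le => [|i _].
- by case: (maxP d).
- have [m0 mP] := maxP d; rewrite -(qf_udiag_row s i Qu) -ZE'.
  exact: (qf_udiag_row_le i (unitary_partial_isometry Qu) Pu m0 mP).
- by case: (maxP s).
- have [m0 mP] := maxP s; rewrite -(qf_udiag_row d i Pu) ZE'.
  exact: (qf_udiag_row_le i (unitary_partial_isometry Pu) Qu m0 mP).
Qed.

Lemma symabsmxE n (Z : 'M[C]_n) :
  symabsmx Z = (2^-1 : R)%:C *: (absmx Z + absmx (Z^t*)).
Proof. by rewrite /symabsmx fmorphV rmorph_nat. Qed.

Lemma qf_symabsmx n (Z : 'M[C]_n) u :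
  qf (symabsmx Z) u = (qf (absmx Z) u + qf (absmx (Z^t*)) u) / 2.
Proof. by rewrite symabsmxE qf_scale qfD mulrC. Qed.

Lemma psd_symabsmx n (Z : 'M[C]_n) : psd (symabsmx Z).
Proof.
rewrite symabsmxE; apply: psd_scale; first by rewrite invr_ge0.
exact: psdD (absmxP Z).1 (absmxP (Z^t*)).1.
Qed.

(** The singular value is [u_i S v_i^*] for singular vectors [u_i], [v_i] of the
    sum; the bound for each summand is then added up. *)
Lemma singular_value_sum_le (I : finType) n (A : I -> 'M[C]_n) :
  let S := \sum_k A k in
  let X := \sum_k absmx (A k) in let Y := \sum_k absmx ((A k)^t*) in
  exists P U : 'M[C]_n, [/\ P \is unitarymx, U *m U^t* *m U = U &
    forall i, singular_value S i <= (qf Y (row i U) + qf X (row i P)) / 2].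
Proof.
move=> S X Y; have [_ [P [U [[Pu UUU] _ SE _ _]]]] := svd S.
exists P, U; split=> // i.
have -> : singular_value S i = complex.Re ((row i U *m S *m (row i P)^t*) 0 0).
  have -> : singular_value S i = complex.Re ((U *m S *m P^t*) i i).
    by rewrite SE !mxE eqxx.
  by rewrite mxE -row_mul [in RHS]mxE; congr complex.Re; apply: eq_bigr => j _; rewrite !mxE.
rewrite /S mulmx_sumr mulmx_suml summxE Re_sum /X /Y !qf_sum -big_split mulr_suml /=.
by apply: ler_sum => k _; exact: abs_bilinear_le.
Qed.

Lemma qf_sum_symabsmx (I : finType) n (A : I -> 'M[C]_n) u :
  qf (\sum_k absmx (A k)) u + qf (\sum_k absmx ((A k)^t*)) u =
  2 * qf (\sum_k symabsmx (A k)) u.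
Proof.
rewrite !qf_sum -big_split mulr_sumr; apply: eq_bigr => k _.
by rewrite qf_symabsmx /= mulrC divfK.
Qed.

(** Jensen at the midpoint, the Peierls inequality and McCarthy's inequality give
    [Tr |S|^r <= (Tr X^r + Tr Y^r) / 2 <= Tr (X + Y)^r / 2], where [X] and [Y] sum
    the moduli and the adjoint moduli; finally [X + Y] is twice the sum [N] of the
    symmetric moduli, and [2^r / 2 = 2^(r-1)]. *)
Lemma schatten_sum_le_fin (I : finType) n (A : I -> 'M[C]_n) r : 1 <= r ->
  schatten r%:E (\sum_k A k) <=
    2 `^ (1 - r^-1) * schatten r%:E (\sum_k symabsmx (A k)).
Proof.
move=> r1; have r0 : 0 < r by lra.
set S := \sum_k A k; set N := \sum_k symabsmx (A k).
have [P [U [Pu UUU sle]]] := singular_value_sum_le A.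
set X := \sum_k absmx (A k) in sle; set Y := \sum_k absmx ((A k)^t*) in sle.
have Npsd : psd N by apply: psd_sum => k; exact: psd_symabsmx.
have Xpsd : psd X by apply: psd_sum => k; case: (absmxP (A k)).
have Ypsd : psd Y by apply: psd_sum => k; case: (absmxP ((A k)^t*)).
have NN : absmx N = N := absmx_psd_id Npsd.
have [Q [nu [Qu nu0 NE]]] := psd_diagonalization Npsd; 
have [PX [x [Xu x0 XE]]] := psd_diagonalization Xpsd.
have [PY [y [Yu y0 YE]]] := psd_diagonalization Ypsd.
have [s0 [P' [_ [[P'u _] _ _ SE _]]]] := svd S.
rewrite (schatten_fin r P'u SE) (schatten_fin r Qu (etrans NN NE)).
have XYN u : qf (udiag PX x) u + qf (udiag PY y) u =
    qf (udiag Q (fun i => 2 * nu i)) u.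
  rewrite -XE -YE qf_sum_symabsmx -/N [in LHS]NE !qf_udiag mulr_sumr.
  by apply: eq_bigr => j _; rewrite mulrA.
have XYle : \sum_i x i `^ r + \sum_i y i `^ r <= \sum_j (2 * nu j) `^ r.
  by apply: (mccarthy Xu Yu Qu x0 y0 _ XYN r1) => j; rewrite mulr_ge0.
have sxy : \sum_i singular_value S i `^ r <=
    (\sum_i y i `^ r + \sum_i x i `^ r) / 2.
  have PPP := unitary_partial_isometry Pu.
  apply: (@le_trans _ _
    ((\sum_i qf Y (row i U) `^ r + \sum_i qf X (row i P) `^ r) / 2)).
    rewrite -big_split mulr_suml; apply: ler_sum => i _ /=.
    have qX0 : 0 <= qf X (row i P) by case: Xpsd.
    have qY0 : 0 <= qf Y (row i U) by case: Ypsd.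
    apply: le_trans (powR_midpoint r1 qY0 qX0).
    by apply: ge0_ler_powR; rewrite ?nnegrE ?divr_ge0 ?addr_ge0// ltW.
  rewrite ler_pM2r ?invr_gt0// XE YE.
  exact: lerD (sum_powR_qf_le r1 UUU Yu y0) (sum_powR_qf_le r1 PPP Xu x0).
have sn : \sum_i singular_value S i `^ r <= 2 `^ (r - 1) * \sum_j nu j `^ r.
  apply: le_trans sxy _; rewrite addrC ler_pdivrMr// (le_trans XYle)//.
  rewrite mulrAC [2 `^ _ * 2]mulrC mulr_powRB1// mulr_sumr le_eqVlt.
  by apply/orP; left; apply/eqP/eq_bigr => j _; rewrite powRM.
have sum0 (f : 'I_n -> R) : 0 <= \sum_i f i `^ r.
  by rewrite sumr_ge0// => i _; exact: powR_ge0.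
have -> : 2 `^ (1 - r^-1) = (2 `^ (r - 1)) `^ r^-1 :> R.
  by rewrite -powRrM mulrBl divff ?gt_eqF// mul1r.
rewrite -powRM ?powR_ge0//.
by apply: ge0_ler_powR; rewrite ?nnegrE ?invr_ge0 ?mulr_ge0 ?powR_ge0// ltW.
Qed.

Lemma schatten_sum_le_inf (I : finType) n (A : I -> 'M[C]_n) :
  schatten +oo%E (\sum_k A k) <= 2 * schatten +oo%E (\sum_k symabsmx (A k)).
Proof.
set S := \sum_k A k; set N := \sum_k symabsmx (A k).
have [P [U [Pu UUU sle]]] := singular_value_sum_le A.
have Npsd : psd N by apply: psd_sum => k; exact: psd_symabsmx.
have NN : absmx N = N := absmx_psd_id Npsd.
have [Q [nu [Qu nu0 NE]]] := psd_diagonalization Npsd.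
rewrite (schatten_inf Qu nu0 (etrans NN NE)).
set M := \big[Num.max/0]_i nu i.
have M0 : 0 <= M by exact: bigmax_ge_id.
have nuM i : nu i <= M by exact: le_bigmax.
rewrite /schatten; apply: bigmax_le => [|i _]; first by rewrite mulr_ge0.
apply: le_trans (sle i) _; rewrite ler_pdivrMr// -mulrA.
have qX u : qf (\sum_k absmx (A k)) u <= 2 * qf N u.
  rewrite -qf_sum_symabsmx lerDl qf_sum sumr_ge0// => k _.
  by case: (absmxP ((A k)^t*)) => -[].
have qY u : qf (\sum_k absmx ((A k)^t*)) u <= 2 * qf N u.
  rewrite -qf_sum_symabsmx lerDr qf_sum sumr_ge0// => k _.
  by case: (absmxP (A k)) => -[].
have qN V : V *m V^t* *m V = V -> qf N (row i V) <= M.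
  by move=> VVV; rewrite NE; exact: (qf_udiag_row_le i VVV Qu M0 nuM).
apply: le_trans (lerD (qY _) (qX _)) _.
rewrite -mulrDr ler_pM2l// mulr_natr mulr2n.
exact: lerD (qN _ UUU) (qN _ (unitary_partial_isometry Pu)).
Qed.

Lemma schatten_sum_le (I : finType) n (A : I -> 'M[C]_n) (p : \bar R) : (1 <= p)%E ->
  schatten p (\sum_k A k) <=
    2 `^ (1 - fine p^-1%E) * schatten p (\sum_k symabsmx (A k)).
Proof.
case: p => [r||//] p1.
  have r1 : 1 <= r by rewrite -lee_fin.
  by rewrite inver gt_eqF ?schatten_sum_le_fin//; lra.
by rewrite /= subr0 powRr1// schatten_sum_le_inf.
Qed.

End SchattenNorm.

(** * An extremal matrix *)

Section Sharpness.
Variable R : realType.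
Local Notation C := R[i].

Lemma rdiag_udiag n (d : 'I_n -> R) : rdiag d = udiag 1%:M d.
Proof. by rewrite /udiag mulmx1 trmx1 map_mx1 mul1mx. Qed.

Lemma unitarymx1 n : (1%:M : 'M[C]_n) \is unitarymx.
Proof. by apply/unitarymxP; rewrite trmx1 map_mx1 mulmx1. Qed.

Lemma absmx_rdiag n (Z : 'M[C]_n) (d : 'I_n -> R) : (forall i, 0 <= d i) ->
  Z^t* *m Z = rdiag (fun i => d i * d i) -> absmx Z = rdiag d.
Proof.
move=> d0 ZZ; apply: absmx_unique; first by rewrite rdiag_udiag; exact: udiag_psd.
by rewrite rdiag_mul.
Qed.

Lemma trmxC_delta m n (i : 'I_m) (j : 'I_n) :
  (delta_mx i j : 'M[C]_(m, n))^t* = delta_mx j i.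
Proof.
by apply/matrixP => k l; rewrite !mxE andbC; case: (_ && _); rewrite ?rmorph1 ?rmorph0.
Qed.

Lemma absmx_delta n (i j : 'I_n) :
  absmx (delta_mx i j : 'M[C]_n) = rdiag (fun k => (k == j)%:R).
Proof.
apply: absmx_rdiag => [k|]; first exact: ler0n.
rewrite trmxC_delta mul_delta_mx; apply/matrixP => k l; rewrite !mxE.
have [->|kl] := eqVneq k l.
  by rewrite mulr1n -natrM mulnb andbb rmorph_nat.
case: eqVneq => [kj|_] //=; rewrite mulr0n.
by case: eqVneq => //= lj; rewrite kj lj eqxx in kl.
Qed.

Lemma symabsmx_delta n (i j : 'I_n) :
  symabsmx (delta_mx i j : 'M[C]_n) =
  rdiag (fun k => 2^-1 * ((k == i)%:R + (k == j)%:R)).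
Proof.
rewrite symabsmxE trmxC_delta !absmx_delta; apply/matrixP => k l; rewrite !mxE.
case: (k == l); last by rewrite !mulr0n addr0 mulr0.
by rewrite !mulr1n -rmorphD -rmorphM addrC.
Qed.

Lemma symabsmx0 n : symabsmx (0 : 'M[C]_n) = 0.
Proof.
have -> : symabsmx (0 : 'M[C]_n) = rdiag (fun=> 0).
  have a0 : absmx (0 : 'M[C]_n) = rdiag (fun=> 0).
    apply: absmx_rdiag => //; rewrite mulmx0.
    by apply/matrixP => k l; rewrite !mxE mulr0 mul0rn.
  rewrite symabsmxE trmx0 map_mx0 a0.
  by apply/matrixP => k l; rewrite !mxE mul0rn addr0 mulr0.
by apply/matrixP => k l; rewrite !mxE mul0rn.
Qed.

Lemma schatten_delta n (i j : 'I_n) (p : \bar R) : (1 <= p)%E ->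
  schatten p (delta_mx i j : 'M[C]_n) = 1.
Proof.
have ZE := absmx_delta i j; rewrite rdiag_udiag in ZE.
have d0 (k : 'I_n) : 0 <= (k == j)%:R :> R by exact: ler0n.
case: p => [r||//] p1.
  have r1 : 1 <= r by rewrite -lee_fin.
  rewrite (schatten_fin r (unitarymx1 n) ZE) (bigD1 j)//= eqxx powR1 big1 => [|k /negbTE->].
    by rewrite addr0 powR1.
  by rewrite powR0// gt_eqF//; lra.
rewrite (schatten_inf (unitarymx1 n) d0 ZE); apply/eqP; rewrite eq_le.
apply/andP; split; first by apply: bigmax_le => // k _; rewrite lern1; case: (_ == _).
by apply: le_trans (le_bigmax _ _ j); rewrite eqxx.
Qed.

(** Together with [schatten_delta], the extremal pair: the symmetric modulus of
    an off-diagonal unit matrix spreads its single singular value [1] into two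
    singular values [1/2]. *)
Lemma schatten_symabsmx_delta n (i j : 'I_n) (p : \bar R) : i != j -> (1 <= p)%E ->
  schatten p (symabsmx (delta_mx i j : 'M[C]_n)) = 2 `^ (fine p^-1%E - 1).
Proof.
move=> ij; set d := fun k : 'I_n => 2^-1 * ((k == i)%:R + (k == j)%:R) : R.
have d0 k : 0 <= d k by rewrite mulr_ge0 ?invr_ge0 ?addr_ge0 ?ler0n.
have ZE : absmx (symabsmx (delta_mx i j : 'M[C]_n)) = udiag 1%:M d.
  by rewrite symabsmx_delta absmx_psd_id ?rdiag_udiag//; apply: udiag_psd.
have di : d i = 2^-1 by rewrite /d eqxx (negbTE ij) addr0 mulr1.
have dj : d j = 2^-1 by rewrite /d eqxx eq_sym (negbTE ij) add0r mulr1.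
have dk k : k != i -> k != j -> d k = 0.
  by move=> /negbTE ki /negbTE kj; rewrite /d ki kj addr0 mulr0.
case: p => [r||//] p1.
  have r1 : 1 <= r by rewrite -lee_fin.
  have r0 : r != 0 by rewrite gt_eqF//; lra.
  rewrite (schatten_fin r (unitarymx1 n) ZE) inver (negbTE r0) /=.
  rewrite (bigD1 i)//= (bigD1 j) 1?eq_sym//= big1 => [|k /andP[ki kj]]; last first.
    by rewrite dk// powR0.
  rewrite di dj addr0 -mulr2n -[_ `^ r *+ 2]mulr_natl powRM ?powR_ge0//.
  rewrite -powRrM divff// powRr1 ?invr_ge0//.
  by rewrite powRB ?powRr1// pnatr_eq0 implybT.
rewrite (schatten_inf (unitarymx1 n) d0 ZE) /= sub0r powR_inv1//.
apply/eqP; rewrite eq_le; apply/andP; split.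
  apply: bigmax_le => [|k _]; first by rewrite invr_ge0.
  have [->|ki] := eqVneq k i; first by rewrite di.
  have [->|kj] := eqVneq k j; first by rewrite dj.
  by rewrite dk// invr_ge0.
by rewrite -di; exact: le_bigmax.
Qed.

End Sharpness.

(* [fine p^-1%E] is the real number 1/p, with 1/oo = 0. *)
Theorem theorem1p15 (R : realType) (m n : nat) (p : \bar R)
    (hm : (2 <= m)%N) (hn : (2 <= n)%N) (hp : (1 <= p)%E) :
  (forall A : 'I_m -> 'M[R[i]]_n,
     schatten p (\sum_(k < m) A k) <=
       2 `^ (1 - fine p^-1%E) * schatten p (\sum_(k < m) symabsmx (A k))) /\
  (forall c : R,
     (forall A : 'I_m -> 'M[R[i]]_n,
        schatten p (\sum_(k < m) A k) <=
          c * schatten p (\sum_(k < m) symabsmx (A k))) ->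
     2 `^ (1 - fine p^-1%E) <= c).
Proof.
split=> [A|c cP]; first exact: schatten_sum_le.
pose k0 : 'I_m := Ordinal (ltnW hm).
pose i : 'I_n := Ordinal (ltnW hn); pose j : 'I_n := Ordinal hn.
pose E : 'M[R[i]]_n := delta_mx i j.
have sum_k0 (F : 'I_m -> 'M[R[i]]_n) :
    (forall k, k != k0 -> F k = 0) -> \sum_k F k = F k0.
  by move=> F0; rewrite (bigD1 k0)//= big1 ?addr0.
have := cP (fun k => if k == k0 then E else 0).
rewrite !sum_k0 => [|k /negbTE->|k /negbTE->//]; last exact: symabsmx0.
rewrite eqxx schatten_delta// schatten_symabsmx_delta//.
rewrite -[fine _ - 1]opprB powRN ler_pdivlMr ?powR_gt0//.
by rewrite mul1r.
Qed.
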